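(* Let $R$ be a commutative associative ring with unit and without zero divisors. Let $\Phi$ be an automorphism of $(Rep\text{-}R)^0$ such that $\Phi((W_1,F_1))$ is isomorphic to $(W_1,F_1)$. Then $\Phi$ is semi-inner: there exist an automorphism $\varphi$ of the ring $R$ and an inner automorphism $\Psi$ of $(Rep\text{-}R)^0$ such that $$\Phi=\hat\varphi\circ\Psi,$$ where $\hat\varphi$ is the standard twisted $\varphi$-automorphism.
   Context: Representations: a representation $(A,G,\cdot)$ is a unital $R$-module $A$ with a right action of a group $G$ by $R$-module automorphisms satisfying $(a\cdot g_1)\cdot g_2=a\cdot(g_1g_2)$. A homomorphism is a pair $(\mu^{(1)},\mu^{(2)})$ of an $R$-linear map and a group homomorphism with $\mu^{(1)}(a\cdot g)=\mu^{(1)}(a)\bullet\mu^{(2)}(g)$; composition is componentwise. Free representations and the category: the free representation over $(Y,X)$ is $(W,F)$, where $F$ is the free group on $X$ and $W$ is the free right $RF$-module on $Y$, with the action given by module multiplication. $(Rep\text{-}R)^0$ is the full category of free representations over pairs of finite subsets of fixed infinite sets $Y_0$ and $X_0$. $(W_1,F_1)$ is the free representation over one module generator and one group generator: $F_1$ is infinite cyclic and $W_1=RF_1$. Inner automorphisms: an automorphism $\Psi$ is inner if for every object there is an isomorphism of representations $\sigma_{WF}:(W,F)\to\Psi(W,F)$ with $\Psi(\mu)=\sigma\circ\mu\circ\sigma^{-1}$ componentwise. Standard twisted automorphism: for a ring automorphism $\varphi$ of $R$ and a free representation $(W,F)$ with module basis $Y$, let $\varphi_{WF}:W\to W$ be defined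 by $$\sum_{y\in Y}y\sum_{g}r_{y,g}\,g\;\mapsto\;\sum_{y\in Y}y\sum_g\varphi(r_{y,g})\,g.$$ The standard twisted $\varphi$-automorphism $\hat\varphi$ fixes all objects and sends a homomorphism $\mu:(W,F)\to(W',F')$ to $(\varphi_{W'F'}\circ\mu^{(1)}\circ\varphi_{WF}^{-1},\;\mu^{(2)})$. *)

(* Defs.v *)
From HB Require Import structures.
From mathcomp Require Import all_boot all_algebra.
From mathcomp Require Import finmap.
Set Implicit Arguments.
Unset Strict Implicit.
Unset Printing Implicit Defensive.
Import GRing.Theory.
Local Open Scope ring_scope.

(* Free group on an alphabet L : reduced words over L x bool           *)
(* (true = the letter, false = its inverse).                          *)
Section FreeGroup.
Variable L : eqType.
Definition letter := (L * bool)%type.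
Definition cancels (a b : letter) := (a.1 == b.1) && (a.2 != b.2).
Definition step (a : letter) (r : seq letter) :=
  if r is b :: r' then (if cancels a b then r' else a :: r) else [:: a].
Definition reduce (w : seq letter) : seq letter := foldr step [::] w.
Fixpoint okw (w : seq letter) : bool :=
  if w is a :: w' then
    (if w' is b :: _ then ~~ cancels a b else true) && okw w'
  else true.

Lemma okw_reduce w : okw (reduce w).
Proof.
elim: w => //= a w IH; rewrite /step.
case E: (reduce w) IH => [|b r] //=.
case: ifP => Hc /=.
  by case: r E => //= c r _ /andP[].
by rewrite Hc.
Qed.

Lemma reduce_okw w : okw w -> reduce w = w.
Proof.
elim: w => //= a w IH /andP[H1 H2].
rewrite /= (IH H2) /step.
by case: w H1 {IH H2} => //= b w /negbTE ->.
Qed.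

Lemma reduce_reduced w : reduce (reduce w) == reduce w.
Proof. by rewrite reduce_okw ?okw_reduce. Qed.

Definition FG := {w : seq letter | reduce w == w}.
Definition mkFG (w : seq letter) : FG := exist _ (reduce w) (reduce_reduced w).
Definition fg_one : FG := mkFG [::].
Definition fg_mul (u v : FG) : FG := mkFG (sval u ++ sval v).
Definition fg_inv (u : FG) : FG :=
  mkFG (rev (map (fun a : letter => (a.1, ~~ a.2)) (sval u))).

Lemma step_cancel a b r : cancels a b -> okw r -> step a (step b r) = r.
Proof.
case: a b => [x p] [y q]; rewrite /cancels /= => /andP[/eqP <- Hpq].
case: r => [|[z t] r] /=.
  by rewrite /cancels /= eqxx /=; case: p q Hpq => [] [].
case Hc: (cancels (x, q) (z, t)) => /andP[Hr _].
  move: Hc; rewrite /cancels /= => /andP[/eqP ezx Hqt]; subst z.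
  have et : t = p by case: p q t Hpq Hqt Hr => [] [] [].
  subst t.
  case: r Hr => [|d r] //= Hd; by rewrite (negbTE Hd).
by rewrite /= /cancels /= eqxx /= Hpq.
Qed.

Lemma reduce_cat_r x y : reduce (x ++ reduce y) = reduce (x ++ y).
Proof.
elim: x => /= [|a x ->] //; by rewrite reduce_okw ?okw_reduce.
Qed.

Lemma reduce_cat_l x y : reduce (reduce x ++ y) = reduce (x ++ y).
Proof.
elim: x => //= a x IH; rewrite -IH.
move Er: (reduce x) (okw_reduce x) => r.
case: r Er => [|b r] // _ Hok.
rewrite [step a _]/= /=; case: ifP => Hc //=.
rewrite step_cancel ?okw_reduce //.
Qed.

Lemma fg_mulA u v w : fg_mul (fg_mul u v) w = fg_mul u (fg_mul v w).
Proof.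
apply/val_inj => /=; by rewrite reduce_cat_l reduce_cat_r catA.
Qed.

Lemma reduce_invK (g : seq letter) :
  reduce (rev (map (fun a : letter => (a.1, ~~ a.2)) g) ++ g) = [::].
Proof.
elim: g => //= a g IH.
rewrite rev_cons -cats1 -catA /= -reduce_cat_r /=.
rewrite step_cancel ?okw_reduce ?reduce_cat_r //.
by case: a {IH} => x [] ; rewrite /cancels /= eqxx.
Qed.

Lemma fg_mulVK (k g : FG) : fg_mul (fg_mul k (fg_inv g)) g = k.
Proof.
apply/val_inj => /=; rewrite reduce_cat_l -catA -reduce_cat_r.
rewrite reduce_cat_l reduce_invK cats0; exact/eqP/(svalP k).
Qed.

End FreeGroup.

Definition group_hom (L L' : eqType) (f : FG L -> FG L') :=
  forall u v, f (fg_mul u v) = fg_mul (f u) (f v).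

(* Free right R F-module on Y, F free on X: finitely supported         *)
(* coefficient functions  Y x F -> R  (w = sum_y y sum_g r_{y,g} g).   *)
Section FreeModule.
Variables (R : comNzRingType) (Y X : eqType).
Definition key := (Y * FG X)%type.
Definition finsupp (f : key -> R) := exists s : seq key, forall k, f k != 0 -> k \in s.
Definition W := {f : key -> R | finsupp f}.

Lemma finsupp_add (f g : W) : finsupp (fun k => sval f k + sval g k).
Proof.
case: f g => [f [s Hs]] [g [t Ht]]; exists (s ++ t) => k /= Hk.
rewrite mem_cat; case: (f k =P 0) => [E|/eqP /Hs -> //].
by move: Hk; rewrite E add0r => /Ht ->; rewrite orbT.
Qed.
Definition wadd (f g : W) : W := exist _ _ (finsupp_add f g).

Lemma finsupp_scale (r : R) (f : W) : finsupp (fun k => r * sval f k).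
Proof.
case: f => [f [s Hs]]; exists s => k /= Hk; apply: Hs.
by apply: contraNneq Hk => ->; rewrite mulr0.
Qed.
Definition wscale (r : R) (f : W) : W := exist _ _ (finsupp_scale r f).

(* right action:  (w . g)(y, k) = w(y, k g^-1),  i.e.  y h |-> y (h g) *)
Lemma finsupp_act (f : W) (g : FG X) :
  finsupp (fun k => sval f (k.1, fg_mul k.2 (fg_inv g))).
Proof.
case: f => [f [s Hs]]; exists (map (fun k : key => (k.1, fg_mul k.2 g)) s).
move=> [y k] /= /Hs H; apply/mapP; exists (y, fg_mul k (fg_inv g)) => //=.
by rewrite fg_mulVK.
Qed.
Definition wact (f : W) (g : FG X) : W := exist _ _ (finsupp_act f g).

Lemma finsupp_map (phi : {rmorphism R -> R}) (f : W) :
  finsupp (fun k => phi (sval f k)).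
Proof.
case: f => [f [s Hs]]; exists s => k /= Hk; apply: Hs.
by apply: contraNneq Hk => ->; rewrite rmorph0.
Qed.
Definition wmap (phi : {rmorphism R -> R}) (f : W) : W :=
  exist _ _ (finsupp_map phi f).
End FreeModule.

Section RepCat.
Variables (R : comNzRingType) (Y0 X0 : choiceType).

Definition Obj := ({fset Y0} * {fset X0})%type.
Definition WO (A : Obj) := W R A.1 A.2.
Definition FO (A : Obj) := FG A.2.

Record RHom (A B : Obj) := mkHom {
  hom1 : WO A -> WO B;
  hom2 : FO A -> FO B;
  hom1_add : forall a b, hom1 (wadd a b) = wadd (hom1 a) (hom1 b);
  hom1_scale : forall r a, hom1 (wscale r a) = wscale r (hom1 a);
  hom2_mul : group_hom hom2;
  hom_compat : forall a g, hom1 (wact a g) = wact (hom1 a) (hom2 g)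
}.

Definition idh (A : Obj) : RHom A A :=
  @mkHom A A id id (fun _ _ => erefl) (fun _ _ => erefl) (fun _ _ => erefl)
    (fun _ _ => erefl).

Definition comph (A B C : Obj) (n : RHom B C) (m : RHom A B) : RHom A C.
Proof.
refine (@mkHom A C (hom1 n \o hom1 m) (hom2 n \o hom2 m) _ _ _ _) => /=.
- by move=> a b; rewrite !hom1_add.
- by move=> r a; rewrite !hom1_scale.
- by move=> u v /=; rewrite (hom2_mul m u v) (hom2_mul n).
- by move=> a g; rewrite !hom_compat.
Defined.

Definition iso_obj (A B : Obj) :=
  exists (s : RHom A B) (t : RHom B A), comph t s = idh A /\ comph s t = idh B.

Definition is_cat_aut (Fo : Obj -> Obj)
    (Fh : forall A B, RHom A B -> RHom (Fo A) (Fo B)) :=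
  [/\ bijective Fo,
      forall A B, bijective (@Fh A B),
      forall A, Fh A A (idh A) = idh (Fo A) &
      forall A B C (n : RHom B C) (m : RHom A B),
        Fh A C (comph n m) = comph (Fh B C n) (Fh A B m)].

Definition is_inner (Fo : Obj -> Obj)
    (Fh : forall A B, RHom A B -> RHom (Fo A) (Fo B)) :=
  exists (s : forall A, RHom A (Fo A)) (si : forall A, RHom (Fo A) A),
    (forall A, comph (si A) (s A) = idh A /\ comph (s A) (si A) = idh (Fo A)) /\
    (forall A B (m : RHom A B), Fh A B m = comph (s B) (comph m (si A))).
End RepCat.

(* Main.v *)
Require Import Defs.
From HB Require Import structures.
From mathcomp Require Import all_boot all_algebra.
From mathcomp Require Import finmap.
From mathcomp Require Import boolp.
Set Implicit Arguments.
Unset Strict Implicit.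
Unset Printing Implicit Defensive.
Import GRing.Theory.
Open Scope fset_scope.
Local Open Scope ring_scope.

(* Write (n,m) for the free representation on n module and m group generators.
   In the monoid End(1,1) the projection y -> 0, x -> x is the only central
   idempotent besides 0 and 1, hence it is fixed by the automorphism of End(1,1)
   that Phi induces.  The homs from (1,1) to A form W_A x F_A, so Phi yields natural
   bijections s1 : W_A -> W_(Phi A) and s2 : F_A -> F_(Phi A).  By naturality every
   operation pulled back along s1 and s2 is given by an element of a free object:
   - addition is c = alpha y + beta y' in W_(2,0), and alpha = beta = 1 because s1
     maps 0 to 0;
   - scalar multiplication by r is psi(r) in W_(1,0) = R, which makes psi a ring
     automorphism;
   - the action is q in W_(1,1) = R[x, x^-1] with q(x1) q(x2) = q(w) for some w in
     F_(0,2).  Comparing coefficients, q is a single group element, and it has to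
     generate the infinite cyclic group, so q = x or q = x^-1.
   After replacing s2 by its composite with inversion if q = x^-1, (s1, s2) respects
   the actions, s2 is multiplicative because the free modules are faithful, and
   twisting s1 by psi makes it linear. *)

(** * Free groups: group laws and the exponent sum *)

Section FreeGroupTheory.
Variable L : eqType.
Implicit Types (u v w : FG L) (a : letter L).

Definition fg_gen (x : L) : FG L := mkFG [:: (x, true)].

Lemma mkFG_sval u : mkFG (sval u) = u.
Proof. by apply: val_inj => /=; apply/eqP/(svalP u). Qed.

Lemma mkFG_cat s t : mkFG (s ++ t) = fg_mul (mkFG s) (mkFG t) :> FG L.
Proof. by apply: val_inj; rewrite /= reduce_cat_l reduce_cat_r. Qed.

Lemma fg_mul1g u : fg_mul (fg_one L) u = u.
Proof. by rewrite -[u]mkFG_sval -mkFG_cat. Qed.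

Lemma fg_mulg1 u : fg_mul u (fg_one L) = u.
Proof. by rewrite -[u]mkFG_sval -mkFG_cat cats0. Qed.

Lemma fg_mulVg u : fg_mul (fg_inv u) u = fg_one L.
Proof. by rewrite -[fg_inv u]fg_mul1g fg_mulVK. Qed.

Lemma fg_invK : involutive (@fg_inv L).
Proof.
move=> u; rewrite -[RHS]fg_mul1g -(fg_mulVg (fg_inv u)) fg_mulA.
by rewrite fg_mulVg fg_mulg1.
Qed.

Lemma fg_mulgV u : fg_mul u (fg_inv u) = fg_one L.
Proof. by rewrite -{1}[u]fg_invK fg_mulVg. Qed.

Lemma fg_mulKg u v : fg_mul (fg_inv u) (fg_mul u v) = v.
Proof. by rewrite -fg_mulA fg_mulVg fg_mul1g. Qed.

Lemma fg_mulgK u v : fg_mul (fg_mul v u) (fg_inv u) = v.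
Proof. by rewrite fg_mulA fg_mulgV fg_mulg1. Qed.

Lemma fg_invM u v : fg_inv (fg_mul u v) = fg_mul (fg_inv v) (fg_inv u).
Proof.
by rewrite -[RHS](fg_mulgK (fg_mul u v)) -fg_mulA fg_mulVK fg_mulVg fg_mul1g.
Qed.

Lemma mkFG_cons a s : mkFG (a :: s) = fg_mul (mkFG [:: a]) (mkFG s).
Proof. exact: (mkFG_cat [:: a]). Qed.

Lemma mkFG_letter (x : L) b :
  mkFG [:: (x, b)] = if b then fg_gen x else fg_inv (fg_gen x).
Proof. by case: b => //; apply: val_inj. Qed.

Definition expo_letter (a : letter L) : int := if a.2 then 1 else -1.
Definition expo_word (s : seq (letter L)) : int := \sum_(a <- s) expo_letter a.
(** The exponent sum, a homomorphism to the integers taking each generator to 1. Over a one-letter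
    alphabet it identifies the free group with the additive group of integers. *)
Definition expo u := expo_word (sval u).

(** The two letters of a cancelling pair contribute opposite signs. *)
Lemma expo_word_reduce s : expo_word (reduce s) = expo_word s.
Proof.
elim: s => //= a s IH; rewrite [RHS]/expo_word big_cons -/(expo_word s) -IH.
case: (reduce s) => [|b r] /=; first by rewrite /expo_word big_seq1 big_nil addr0.
case: ifP => [/andP[_]|_]; rewrite /expo_word !big_cons // addrA /expo_letter.
by case: a.2 b.2 => [] [] // _; rewrite ?subrr ?addNr add0r.
Qed.

Lemma expo_mul u v : expo (fg_mul u v) = expo u + expo v.
Proof. by rewrite /expo /= expo_word_reduce /expo_word big_cat. Qed.

Lemma expo_gen x : expo (fg_gen x) = 1.
Proof. by rewrite /expo /expo_word big_seq1. Qed.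

(* A reduced word over a single letter is constant, so its length is the absolute
   value of its exponent. *)
Lemma cyclic_abs_expo u :
  (forall x y : L, x = y) -> `|expo u|%N = size (sval u).
Proof.
move=> L1; have: okw (sval u) by rewrite -(eqP (svalP u)) okw_reduce.
rewrite /expo; move: (sval u) => s.
suff H : okw s -> forall a, ohead s = Some a -> expo_word s = expo_letter a * (size s)%:Z.
  case: s H => [|a s] H ok; first by rewrite /expo_word big_nil.
  by rewrite (H ok a) // abszM /expo_letter; case: a.2; rewrite mul1n.
elim: s => //= a [|b s] IH; rewrite /expo_word big_cons.
  by rewrite big_nil addr0 => _ _ [<-]; rewrite mulr1.
rewrite -/(expo_word _) => /andP[nab ok] _ [<-].
rewrite (IH ok b) //; have -> : expo_letter b = expo_letter a.
  move: nab; rewrite /cancels (L1 a.1 b.1) eqxx /= negbK /expo_letter.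
  by move/eqP->.
by rewrite [in RHS]intS mulrDr mulr1.
Qed.

Lemma cyclic_expo0 u : (forall x y : L, x = y) -> expo u = 0 -> u = fg_one L.
Proof.
move=> L1 u0; have := cyclic_abs_expo u L1; rewrite u0 => /esym/size0nil us.
by rewrite -[u]mkFG_sval us.
Qed.

Lemma cyclic_expo1 u x : (forall x y : L, x = y) -> `|expo u|%N = 1%N ->
  u = if expo u == 1 then fg_gen x else fg_inv (fg_gen x).
Proof.
move=> L1; rewrite cyclic_abs_expo //; rewrite -{2}[u]mkFG_sval /expo.
case: (sval u) => [|[z b] [|]] //= _; rewrite (L1 z x) mkFG_letter.
by rewrite /expo_word big_seq1; case: b.
Qed.

End FreeGroupTheory.

(** * Free group homomorphisms and the universal property *)

Section FreeGroupHom.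
Variables (L L' : eqType).

Section HomTheory.
Variables (f : FG L -> FG L') (fM : group_hom f).

Lemma group_hom1 : f (fg_one L) = fg_one L'.
Proof.
have := fM (fg_one L) (fg_one L); rewrite fg_mul1g => h.
by rewrite -[RHS](fg_mulVg (f (fg_one L))) {3}h fg_mulKg.
Qed.

Lemma group_homV u : f (fg_inv u) = fg_inv (f u).
Proof. by rewrite -[RHS]fg_mul1g -group_hom1 -(fg_mulVg u) fM fg_mulgK. Qed.

(** Both sides are additive in [u] and agree on the generator. Composing endomorphisms of the
    infinite cyclic group thus becomes multiplying integers. *)
Lemma expo_cyclic_hom x u : (forall x y : L, x = y) ->
  expo (f u) = expo (f (fg_gen x)) * expo u.
Proof.
move=> L1; rewrite -[u]mkFG_sval; elim: (sval u) => [|[z b] s IH].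
  by rewrite group_hom1 /expo /= /expo_word !big_nil mulr0.
rewrite mkFG_cons fM !expo_mul IH mulrDr; congr (_ + _).
rewrite (L1 z x) mkFG_letter; case: b; first by rewrite expo_gen mulr1.
have V (K : eqType) (v : FG K) : expo (fg_inv v) = - expo v.
  apply/eqP; rewrite -addr_eq0 -expo_mul fg_mulVg.
  by rewrite /expo /= /expo_word big_nil.
by rewrite group_homV !V expo_gen mulrN1.
Qed.

End HomTheory.

Lemma group_hom_ext (f f' : FG L -> FG L') : group_hom f -> group_hom f' ->
  (forall x, f (fg_gen x) = f' (fg_gen x)) -> f =1 f'.
Proof.
move=> fM f'M ff' u; rewrite -[u]mkFG_sval.
elim: (sval u) => [|[x b] s IH]; first by rewrite !group_hom1.
rewrite mkFG_cons fM f'M IH mkFG_letter; congr fg_mul.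
by case: b; rewrite // !group_homV // ff'.
Qed.

Variable h : L -> FG L'.

Definition lift_letter (a : letter L) :=
  if a.2 then h a.1 else fg_inv (h a.1).
Definition lift_word (s : seq (letter L)) :=
  foldr (fun a u => fg_mul (lift_letter a) u) (fg_one L') s.
Definition fg_lift (u : FG L) := lift_word (sval u).

(** [fg_lift] evaluates reduced words only. Invariance under reduction is what makes it
    multiplicative. *)
Lemma lift_word_reduce s : lift_word (reduce s) = lift_word s.
Proof.
elim: s => //= a s <-; case: (reduce s) => //= b r.
case: ifP => //= /andP[/eqP e]; rewrite /lift_letter e => ab.
rewrite -fg_mulA; case: a.2 b.2 ab => [] [] // _.
  by rewrite fg_mulgV fg_mul1g.
by rewrite fg_mulVg fg_mul1g.
Qed.

Lemma fg_lift_hom : group_hom fg_lift.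
Proof.
move=> u v; rewrite /fg_lift /= lift_word_reduce.
by elim: (sval u) => [|a s IH] /=; rewrite ?fg_mul1g // IH fg_mulA.
Qed.

Lemma fg_lift_gen x : fg_lift (fg_gen x) = h x.
Proof. by rewrite /fg_lift /= /lift_letter fg_mulg1. Qed.

End FreeGroupHom.

(** * The free module as an [R]-module with basis the pairs [(y, g)] *)

Section FreeModuleTheory.
Variables (R : comNzRingType) (Y X : eqType).
Local Notation W := (W R Y X).
Local Notation key := (key Y X).
Implicit Types (a b : W) (g h : FG X) (k : key).

Lemma W_ext a b : sval a =1 sval b -> a = b.
Proof.
case: a b => [f fs] [f' fs'] /= /funext ff'; subst f'.
by congr exist; apply: Prop_irrelevance.
Qed.

(** Elements are functions, so equality and choice on [W] are taken classically; the algebraic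
    structures below rest on them. *)
HB.instance Definition _ := gen_eqMixin W.
HB.instance Definition _ := gen_choiceMixin W.

Lemma finsupp0 : Defs.finsupp (fun _ : key => 0 : R).
Proof. by exists [::] => k; rewrite eqxx. Qed.
Definition wzero : W := exist _ _ finsupp0.

Lemma waddA : associative (@wadd R Y X).
Proof. by move=> a b c; apply: W_ext => k /=; rewrite addrA. Qed.
Lemma waddC : commutative (@wadd R Y X).
Proof. by move=> a b; apply: W_ext => k /=; rewrite addrC. Qed.
Lemma wadd0 : left_id wzero (@wadd R Y X).
Proof. by move=> a; apply: W_ext => k /=; rewrite add0r. Qed.
Lemma waddN : left_inverse wzero (wscale (-1)) (@wadd R Y X).
Proof. by move=> a; apply: W_ext => k /=; rewrite mulN1r addNr. Qed.

HB.instance Definition _ := GRing.isZmodule.Build W waddA waddC wadd0 waddN.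

Lemma wscaleA (r s : R) a : wscale r (wscale s a) = wscale (r * s) a.
Proof. by apply: W_ext => k /=; rewrite mulrA. Qed.
Lemma wscale1 : left_id 1 (@wscale R Y X).
Proof. by move=> a; apply: W_ext => k /=; rewrite mul1r. Qed.
Lemma wscaleDr : right_distributive (@wscale R Y X) +%R.
Proof. by move=> r a b; apply: W_ext => k /=; rewrite mulrDr. Qed.
Lemma wscaleDl a : {morph (@wscale R Y X)^~ a : r s / r + s}.
Proof. by move=> r s; apply: W_ext => k /=; rewrite mulrDl. Qed.

HB.instance Definition _ :=
  GRing.Zmodule_isLmodule.Build R W wscaleA wscale1 wscaleDr wscaleDl.

Lemma waddE a b : wadd a b = a + b. Proof. by []. Qed.
Lemma wscaleE r a : wscale r a = r *: a. Proof. by []. Qed.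

Definition wcoord k a : R := sval a k.
#[global] Arguments wcoord : simpl never.

Lemma wcoord_is_linear k : linear (wcoord k : W -> R^o).
Proof. by []. Qed.
HB.instance Definition _ k :=
  GRing.isLinear.Build R W R^o *:%R (wcoord k) (wcoord_is_linear k).

Lemma wcoord_ext a b : wcoord^~ a =1 wcoord^~ b -> a = b.
Proof. exact: W_ext. Qed.

Lemma wactZ r a g : wact (r *: a) g = r *: wact a g.
Proof. exact: W_ext. Qed.

Lemma wact_sum I (s : seq I) (F : I -> W) g :
  wact (\sum_(i <- s) F i) g = \sum_(i <- s) wact (F i) g.
Proof. by apply: (big_morph (@wact R Y X ^~ g)) => [a b|]; apply: W_ext. Qed.

Lemma wact1 a : wact a (fg_one X) = a.
Proof.
apply: W_ext => -[y k] /=; congr (sval a (_, _)).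
by rewrite -[LHS]fg_mulg1 fg_mulVK.
Qed.

Lemma wactM a g h : wact (wact a g) h = wact a (fg_mul g h).
Proof. by apply: W_ext => -[y k] /=; rewrite fg_invM -fg_mulA. Qed.

Lemma wact_inj g : injective (@wact R Y X ^~ g).
Proof.
move=> a b /(congr1 (fun c => wact c (fg_inv g))).
by rewrite !wactM fg_mulgV !wact1.
Qed.

Lemma finsupp_gen k : Defs.finsupp (fun k' : key => (k' == k)%:R : R).
Proof.
exists [:: k] => k'; rewrite inE; by case: (k' == k); rewrite ?eqxx.
Qed.
Definition wgen k : W := exist _ _ (finsupp_gen k).

Lemma wcoord_gen k k' : wcoord k (wgen k') = (k == k')%:R. Proof. by []. Qed.

Lemma wgen_neq0 k : wgen k != 0.
Proof.
apply/eqP => /(congr1 (wcoord k)); rewrite wcoord_gen eqxx raddf0.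
by move/eqP; rewrite oner_eq0.
Qed.

Lemma wgen_inj : injective wgen.
Proof.
move=> k k' /(congr1 (wcoord k)); rewrite !wcoord_gen eqxx; case: eqP => // _.
by move/eqP; rewrite oner_eq0.
Qed.

Lemma wact_gen y g h : wact (wgen (y, g)) h = wgen (y, fg_mul g h).
Proof.
apply: W_ext => -[z k] /=; congr (nat_of_bool _)%:R; rewrite !xpair_eqE.
congr (_ && _); apply/eqP/eqP => [<-|->]; first by rewrite fg_mulVK.
by rewrite fg_mulgK.
Qed.

(** [finsupp] only bounds the support by some list. Filtering that list and removing duplicates
    gives the exact support, so that sums over it count every coefficient once. *)
Lemma supp_subproof a : {s : seq key | uniq s /\ forall k, (k \in s) = (wcoord k a != 0)}.
Proof.
apply: cid; case: (svalP a) => s sP.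
exists (undup [seq k <- s | wcoord k a != 0]); split; first exact: undup_uniq.
move=> k; rewrite mem_undup mem_filter.
by case: (boolP (wcoord k a != 0)) => //= /sP.
Qed.
Definition supp a := sval (supp_subproof a).

Lemma supp_uniq a : uniq (supp a). Proof. by case: (svalP (supp_subproof a)). Qed.
Lemma mem_supp a k : (k \in supp a) = (wcoord k a != 0).
Proof. by case: (svalP (supp_subproof a)). Qed.

(** Keys outside the support contribute zero; elements with different supports can therefore be
    summed over one common list. *)
Lemma sum_supp (V : lmodType R) (F : key -> V) a (s : seq key) :
  uniq s -> {subset supp a <= s} ->
  \sum_(k <- s) wcoord k a *: F k = \sum_(k <- supp a) wcoord k a *: F k.
Proof.
move=> us sub; rewrite (bigID (mem (supp a))) /= [X in _ + X]big1 => [|k].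
  rewrite addr0 -big_filter; apply: perm_big; apply: uniq_perm.
  - exact: filter_uniq.
  - exact: supp_uniq.
  by move=> k; rewrite mem_filter /=; case ks: (k \in supp a); rewrite //= (sub _ ks).
by rewrite mem_supp negbK => /eqP->; rewrite scale0r.
Qed.

Lemma W_expand a : a = \sum_(k <- supp a) wcoord k a *: wgen k.
Proof.
apply: wcoord_ext => k; rewrite linear_sum.
under eq_bigr do rewrite linearZ /= wcoord_gen.
case: (boolP (k \in supp a)) => [ks|]; last first.
  move=> ks; rewrite big_seq big1 => [|k' k's].
    by apply/eqP; move: ks; rewrite mem_supp negbK.
  by case: eqP ks => [->|]; rewrite ?k's // scaler0.
rewrite (bigD1_seq k) ?supp_uniq //= eqxx big1 => [|k' /negbTE].
  by rewrite addr0 [RHS]mulr1.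
by rewrite eq_sym => ->; rewrite scaler0.
Qed.

Section Lift.
Variables (V : lmodType R) (F : key -> V).

Definition wlift a : V := \sum_(k <- supp a) wcoord k a *: F k.

Lemma wlift_is_linear : linear wlift.
Proof.
(* The three supports differ in general, so [s] covers all of them. *)
move=> r a b; pose s := undup (supp a ++ supp b ++ supp (r *: a + b)).
have us : uniq s by exact: undup_uniq.
have S c : {subset supp c <= s} -> wlift c = \sum_(k <- s) wcoord k c *: F k.
  by move=> sub; rewrite /wlift (sum_supp _ us sub).
rewrite !S; first last.
- by move=> k ks; rewrite mem_undup !mem_cat ks /= ?orbT.
- by move=> k ks; rewrite mem_undup !mem_cat ks /= ?orbT.
- by move=> k ks; rewrite mem_undup !mem_cat ks /= ?orbT.
rewrite scaler_sumr -big_split; apply: eq_bigr => k _ /=.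
by rewrite linearP scalerDl scalerA.
Qed.

HB.instance Definition _ :=
  GRing.isLinear.Build R W V *:%R wlift wlift_is_linear.

Lemma wlift_gen k : wlift (wgen k) = F k.
Proof.
rewrite /wlift -(@sum_supp _ _ _ [:: k]) // => [|k'].
  by rewrite big_seq1 wcoord_gen eqxx scale1r.
by rewrite mem_supp wcoord_gen inE; case: (k' == k); rewrite ?eqxx.
Qed.

End Lift.
End FreeModuleTheory.

(** * Homomorphisms of free representations and their universal property *)

Section RepHom.
Variables (R : comNzRingType) (Y0 X0 : choiceType).
Local Notation Obj := (Obj Y0 X0).
Implicit Types A B C : Obj.

Lemma RHom_eqP A B (m m' : RHom R A B) :
  hom1 m =1 hom1 m' -> hom2 m =1 hom2 m' -> m = m'.
Proof.
case: m m' => [f1 f2 p1 p2 p3 p4] [f1' f2' q1 q2 q3 q4] /=.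
move=> /funext e1 /funext e2; subst f1' f2'.
by congr mkHom; apply: Prop_irrelevance.
Qed.

Lemma hom1_is_linear A B (m : RHom R A B) : linear (hom1 m).
Proof. by move=> r a b; rewrite -wscaleE -waddE hom1_add hom1_scale. Qed.
HB.instance Definition _ A B (m : RHom R A B) :=
  GRing.isLinear.Build R (WO R A) (WO R B) *:%R (hom1 m) (hom1_is_linear m).

Definition ygen A (y : A.1) : WO R A := wgen R (y, fg_one A.2).

Lemma wgen_ygen A (k : key A.1 A.2) : wgen R k = wact (ygen k.1) k.2.
Proof. by case: k => y g; rewrite wact_gen fg_mul1g. Qed.

Lemma RHom_ext A B (m m' : RHom R A B) :
  (forall y, hom1 m (ygen y) = hom1 m' (ygen y)) ->
  (forall x, hom2 m (fg_gen x) = hom2 m' (fg_gen x)) -> m = m'.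
Proof.
move=> e1 e2.
have e2' := group_hom_ext (@hom2_mul _ _ _ _ _ m) (@hom2_mul _ _ _ _ _ m') e2.
apply: RHom_eqP => // a; rewrite [a]W_expand !linear_sum.
by apply: eq_bigr => k _; rewrite !linearZ /= wgen_ygen !hom_compat e1 e2'.
Qed.

Section HomLift.
Variables (A B : Obj) (f : A.1 -> WO R B) (h : A.2 -> FO B).

(** The extension is forced on basis elements: y g must go to [f y] acted on by the image of g. *)
Let f1 : WO R A -> WO R B :=
  wlift (fun k => wact (f k.1) (fg_lift h k.2)).

Lemma lift_compat a g : f1 (wact a g) = wact (f1 a) (fg_lift h g).
Proof.
rewrite [a]W_expand wact_sum /f1 !linear_sum wact_sum.
apply: eq_bigr => -[y k] _; rewrite wactZ !linearZ wactZ /= wact_gen.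
by rewrite !wlift_gen /= fg_lift_hom wactM.
Qed.

Lemma lift_hom_subproof : {m : RHom R A B |
  (forall y, hom1 m (ygen y) = f y) /\ (forall x, hom2 m (fg_gen x) = h x)}.
Proof.
exists (@mkHom R Y0 X0 A B f1 (fg_lift h) (linearD _) (linearZ_LR _)
          (fg_lift_hom h) lift_compat); split=> [y|x]; last exact: fg_lift_gen.
by rewrite /= /f1 wlift_gen /= /fg_lift /= wact1.
Qed.
Definition lift_hom := sval lift_hom_subproof.

Lemma lift_hom1 y : hom1 lift_hom (ygen y) = f y.
Proof. by case: (svalP lift_hom_subproof). Qed.

Lemma lift_hom2 x : hom2 lift_hom (fg_gen x) = h x.
Proof. by case: (svalP lift_hom_subproof). Qed.

End HomLift.

Lemma hom1_expand A B (m : RHom R A B) a :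
  hom1 m a =
  \sum_(k <- supp a) wcoord k a *: wact (hom1 m (ygen k.1)) (hom2 m k.2).
Proof.
rewrite {1}[a]W_expand linear_sum; apply: eq_bigr => k _.
by rewrite linearZ /= wgen_ygen hom_compat.
Qed.

Lemma comphA A B C D (m : RHom R C D) (n : RHom R B C) (p : RHom R A B) :
  comph m (comph n p) = comph (comph m n) p.
Proof. exact: RHom_eqP. Qed.

Lemma comph1h A B (m : RHom R A B) : comph (idh R B) m = m.
Proof. exact: RHom_eqP. Qed.

Lemma comphh1 A B (m : RHom R A B) : comph m (idh R A) = m.
Proof. exact: RHom_eqP. Qed.

Lemma hom2_1 A B (m : RHom R A B) : hom2 m (fg_one A.2) = fg_one B.2.
Proof. exact/group_hom1/hom2_mul. Qed.

End RepHom.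

Lemma fset1_sub_eq (K : choiceType) (k : K) (u v : [fset k]) : u = v.
Proof.
apply: val_inj; have := valP u; have := valP v.
by rewrite !in_fset1 => /eqP-> /eqP->.
Qed.

(** Coordinatewise absence of zero divisors. It serves below to cancel a nonzero vector from an
    equality of two of its multiples. *)
Lemma W_torsion_free (R : idomainType) (Y X : eqType) (r : R) (a : W R Y X) :
  r *: a = 0 -> a != 0 -> r = 0.
Proof.
move=> ra0 /eqP an0; apply: contrapT => /eqP rn0; apply: an0.
apply: wcoord_ext => k; move/(congr1 (wcoord k)): ra0.
rewrite linearZ raddf0 => /eqP; rewrite mulf_eq0 (negbTE rn0) => /eqP->.
by [].
Qed.

Lemma inj_surj_bij (T U : Type) (f : T -> U) :
  injective f -> (forall b, exists a, f a = b) -> bijective f.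
Proof.
move=> f_inj f_surj; exists (fun b => sval (cid (f_surj b))).
  by move=> a; apply: f_inj; case: cid.
by move=> b; case: cid.
Qed.

(** * The free representation on one module and one group generator *)

Section Point.
Variables (R : idomainType) (Y0 X0 : choiceType) (y0 : Y0) (x0 : X0).
Local Notation Obj := (Obj Y0 X0).
Implicit Types A B C : Obj.

Definition obj11 : Obj := ([fset y0], [fset x0]).
Definition y11 : WO R obj11 := ygen R (A := obj11) [` fset11 y0].
Definition x11 : FO obj11 := fg_gen (L := [fset x0]) [` fset11 x0].

(** Homomorphisms out of [obj11] are exactly the pairs [(a, g)], so [obj11] represents the functor B
    -> W_B x F_B. *)
Definition hom11 B (a : WO R B) (g : FO B) : RHom R obj11 B :=
  lift_hom (A := obj11) (fun _ => a) (fun _ => g).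

#[global] Arguments hom11 : simpl never.
#[global] Arguments y11 : simpl never.
#[global] Arguments x11 : simpl never.

Lemma hom11_y B (a : WO R B) (g : FO B) : hom1 (hom11 a g) y11 = a.
Proof. exact: lift_hom1. Qed.

Lemma hom11_x B (a : WO R B) (g : FO B) : hom2 (hom11 a g) x11 = g.
Proof. exact: lift_hom2. Qed.

Lemma hom11_eta B (m : RHom R obj11 B) : m = hom11 (hom1 m y11) (hom2 m x11).
Proof.
apply: RHom_ext => [y|x]; first by rewrite (fset1_sub_eq y [` fset11 y0]) hom11_y.
by rewrite (fset1_sub_eq x [` fset11 x0]) hom11_x.
Qed.

Lemma comp_hom11 B C (m : RHom R B C) a g :
  comph m (hom11 a g) = hom11 (hom1 m a) (hom2 m g).
Proof. by rewrite [LHS]hom11_eta /= hom11_y hom11_x. Qed.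

Lemma hom11_id : idh R obj11 = hom11 y11 x11.
Proof. by rewrite [LHS]hom11_eta. Qed.

Lemma hom2_hom11_1 B (a : WO R B) g : hom2 (hom11 a (fg_one B.2)) g = fg_one B.2.
Proof.
apply: (@group_hom_ext _ _ (hom2 (hom11 a (fg_one B.2))) (fun _ => fg_one B.2)).
- exact: hom2_mul.
- by move=> u v; rewrite fg_mul1g.
by move=> x; rewrite lift_hom2.
Qed.

(** The augmentation R[x, x^-1] -> R, that is, evaluation at x = 1. *)
Definition augm (a : WO R obj11) : R := \sum_(k <- supp a) wcoord k a.

Lemma hom1_hom11_1 B (b : WO R B) a : hom1 (hom11 b (fg_one B.2)) a = augm a *: b.
Proof.
rewrite hom1_expand scaler_suml; apply: eq_bigr => k _.
by rewrite hom2_hom11_1 wact1 (fset1_sub_eq k.1 [` fset11 y0]) hom11_y.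
Qed.

Lemma wact_y11 g : wact y11 g = wgen R (([` fset11 y0] : obj11.1), g).
Proof. by rewrite wact_gen fg_mul1g. Qed.

(** Commuting with x -> 1 forces y -> c y, and idempotence gives c = 0 or c = 1. If c = 1, commuting
    with y -> y x forces x -> x; if c = 0, the exponent of the image of x is an idempotent
    integer. *)
Lemma central_idempotent (m : RHom R obj11 obj11) : comph m m = m ->
  (forall n, comph m n = comph n m) ->
  [\/ m = idh R obj11, m = hom11 0 (fg_one _) | m = hom11 0 x11].
Proof.
move=> mm mC; set c := augm (hom1 m y11); set u := hom2 m x11.
have my : hom1 m y11 = c *: y11.
  have := congr1 (fun n => hom1 n y11) (mC (hom11 y11 (fg_one _))).
  by rewrite /= hom11_y hom1_hom11_1.
have cc : c * c = c.
  have := congr1 (fun n => hom1 n y11) mm; rewrite /= my linearZ /= my scalerA.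
  move=> h; apply/eqP; rewrite -subr_eq0; apply/eqP.
  by apply: (W_torsion_free (a := y11)); rewrite ?wgen_neq0 // scalerBl h subrr.
(* Commuting with y -> y x gives c y u = c y x; the coefficients at x are compared. *)
have cu : c != 0 -> u = x11.
  have := congr1 (fun n => hom1 n y11) (mC (hom11 (wact y11 x11) x11)).
  rewrite /= hom11_y hom_compat my linearZ /= hom11_y wactZ !wact_y11 => h c0.
  apply/eqP; apply: contraNT c0 => ux.
  move/(congr1 (wcoord (([` fset11 y0] : obj11.1), x11))): h.
  rewrite !linearZ /= !wcoord_gen eqxx xpair_eqE eqxx /= eq_sym (negbTE ux).
  by rewrite [_ *: 0]mulr0 [_ *: 1]mulr1 => <-.
move/eqP: cc; rewrite -subr_eq0 -{3}[c]mulr1 -mulrBr mulf_eq0 subr_eq0.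
have [c0 _|c0 /= /eqP c1] := eqVneq c 0; last first.
  by apply: Or31; rewrite hom11_id [m]hom11_eta my c1 scale1r -/u cu.
have uu : hom2 m u = u by have := congr1 (fun n => hom2 n x11) mm.
have x1 := @fset1_sub_eq _ x0.
have ee : expo u = expo u * expo u.
  by rewrite -{1}uu (expo_cyclic_hom (@hom2_mul _ _ _ _ _ m) [` fset11 x0] _ x1).
rewrite [m]hom11_eta my c0 scale0r -/u.
move/esym/eqP: ee; rewrite -subr_eq0 -{3}[expo u]mulr1 -mulrBr mulf_eq0 subr_eq0.
case/orP => [/eqP e0|/eqP e1].
  by apply: Or32; rewrite (cyclic_expo0 x1 e0).
by apply: Or33; rewrite (@cyclic_expo1 _ u [` fset11 x0] x1) e1.
Qed.

(** * The natural bijections on modules and groups induced by the automorphism *)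

Section Represent.
Variables (Phio : Obj -> Obj)
  (Phih : forall A B, RHom R A B -> RHom R (Phio A) (Phio B))
  (Phi_aut : is_cat_aut Phih)
  (tau : RHom R (Phio obj11) obj11) (taui : RHom R obj11 (Phio obj11))
  (tauK : comph taui tau = idh R _) (tauiK : comph tau taui = idh R _).

Let PhiC A B C (n : RHom R B C) (m : RHom R A B) :
  Phih (comph n m) = comph (Phih n) (Phih m).
Proof. by case: Phi_aut. Qed.

Let Phi1 A : Phih (idh R A) = idh R (Phio A).
Proof. by case: Phi_aut. Qed.

Let Phi_inj A B : injective (@Phih A B).
Proof. by case: Phi_aut => _ /(_ A B)/bij_inj. Qed.

Let Phi_surj A B n : exists m, @Phih A B m = n.
Proof. by case: Phi_aut => _ /(_ A B)[g _ gK] _ _; exists (g n). Qed.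

(** The action of the functor on homs out of [obj11], with the source moved back to [obj11] along
    [taui]. It is natural in A, and precomposition with k turns into precomposition with [E k],
    where [E] is an automorphism of the monoid of endomorphisms of [obj11]. *)
Let P A (m : RHom R obj11 A) : RHom R obj11 (Phio A) := comph (Phih m) taui.
Let E (k : RHom R obj11 obj11) : RHom R obj11 obj11 := comph tau (P k).

Let P_comp A (m : RHom R obj11 A) k : comph (P m) (E k) = P (comph m k).
Proof.
rewrite /P /E !comphA -[comph (comph (Phih m) _) _]comphA tauK comphh1.
by rewrite PhiC.
Qed.

Let P_nat A B (n : RHom R A B) m : P (comph n m) = comph (Phih n) (P m).
Proof. by rewrite /P PhiC comphA. Qed.

Let P_inj A : injective (@P A).
Proof.
move=> m m' /(congr1 (fun n => comph n tau)).
by rewrite /P -!comphA tauK !comphh1; apply: Phi_inj.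
Qed.

Let P_surj A n : exists m, @P A m = n.
Proof.
have [m mE] := Phi_surj (comph n tau); exists m.
by rewrite /P mE -comphA tauiK comphh1.
Qed.

Let E_comp k l : E (comph k l) = comph (E k) (E l).
Proof. by rewrite [in RHS]/E -comphA P_comp. Qed.

Let E_inj : injective E.
Proof.
move=> k l /(congr1 (comph taui)).
by rewrite /E !comphA tauK !comph1h; apply: P_inj.
Qed.

Let E_surj n : exists k, E k = n.
Proof.
have [k kE] := P_surj (comph taui n); exists k.
by rewrite /E kE comphA tauiK comph1h.
Qed.

Let E1 : E (idh R obj11) = idh R obj11.
Proof. by rewrite /E /P Phi1 comph1h. Qed.

(** [zz] is the zero of the endomorphism monoid, [ee] kills the module and keeps the group, and [e0]
    keeps y and kills the group. *)
Let zz : RHom R obj11 obj11 := hom11 0 (fg_one _).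
Let ee : RHom R obj11 obj11 := hom11 0 x11.
Let e0 : RHom R obj11 obj11 := hom11 y11 (fg_one _).

Let zzl m : comph zz m = zz.
Proof. by rewrite [m]hom11_eta comp_hom11 hom1_hom11_1 hom2_hom11_1 scaler0. Qed.

Let zzr m : comph m zz = zz.
Proof. by rewrite comp_hom11 linear0 hom2_1. Qed.

Let Ezz : E zz = zz.
Proof.
have [k kE] := E_surj zz.
by rewrite -(zzl k) E_comp kE zzr.
Qed.

Let ee_n n : comph ee n = comph n ee.
Proof.
rewrite [n]hom11_eta !comp_hom11 linear0 hom11_x; congr hom11.
  rewrite hom1_expand big1 // => k _.
  by rewrite (fset1_sub_eq k.1 [` fset11 y0]) hom11_y -(scale0r y11) wactZ !scale0r scaler0.
apply: (@group_hom_ext _ _ (hom2 ee) id) => //; first exact: hom2_mul.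
by move=> x; rewrite (fset1_sub_eq x [` fset11 x0]) hom11_x.
Qed.

Let ee_neq1 : ee <> idh R obj11.
Proof.
move=> /(congr1 (fun n => hom1 n y11)); rewrite hom11_y /= => /esym/eqP.
by rewrite (negbTE (wgen_neq0 _ _)).
Qed.

Let ee_neq0 : ee <> zz.
Proof.
move=> /(congr1 (fun n => expo (hom2 n x11))).
by rewrite !hom11_x expo_gen /expo /= /expo_word big_nil.
Qed.

(** [E ee] is again a central idempotent, and injectivity of [E] rules out the identity and [zz]. *)
Let Eee : E ee = ee.
Proof.
have [||Ee1|Ee0|//] := @central_idempotent (E ee).
- by rewrite -E_comp comp_hom11 linear0 hom11_x.
- by move=> n; have [k <-] := E_surj n; rewrite -!E_comp ee_n.
- by case: ee_neq1; apply: E_inj; rewrite Ee1 E1.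
- by case: ee_neq0; apply: E_inj; rewrite Ee0 Ezz.
Qed.

Let d := E e0.

(** Apply [E] to the relation e0 ee = zz, whose factor [ee] and value [zz] are fixed. *)
Let d2 : hom2 d x11 = fg_one _.
Proof.
have : comph d ee = zz by rewrite -Eee -E_comp comp_hom11 linear0 hom2_hom11_1 Ezz.
by rewrite comp_hom11 => /(congr1 (fun n => hom2 n x11)); rewrite !hom11_x.
Qed.

(** Since [d] kills the group, it multiplies its own image p of y by the augmentation of p.
    Idempotence leaves p unchanged, and p is nonzero because [e0] differs from [zz]. *)
Let augm_d : augm (hom1 d y11) = 1.
Proof.
have dd : comph d d = d.
  by rewrite -E_comp comp_hom11 hom11_y hom2_1.
have dE : d = hom11 (hom1 d y11) (fg_one _) by rewrite [LHS]hom11_eta d2.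
have /eqP d0 : hom1 d y11 <> 0.
  move=> d0; have /E_inj e00 : E e0 = E zz by rewrite Ezz -/d dE d0.
  have /eqP := congr1 (fun n => hom1 n y11) e00; rewrite !hom11_y.
  by rewrite (negbTE (wgen_neq0 _ _)).
apply/eqP; rewrite -subr_eq0; apply/eqP.
apply: (W_torsion_free (a := hom1 d y11)) => //.
have ddy : hom1 d (hom1 d y11) = hom1 d y11 := congr1 (fun n => hom1 n y11) dd.
by rewrite scalerBl scale1r -hom1_hom11_1 -dE ddy subrr.
Qed.

Let s1 A (a : WO R A) := hom1 (P (hom11 a (fg_one _))) y11.
Let s2 A (g : FO A) := hom2 (P (hom11 0 g)) x11.

(** The pairs [(a, 1)] absorb [e0] on the right, so their images absorb [d], which kills the
    group. *)
Let s1E A (a : WO R A) : P (hom11 a (fg_one _)) = hom11 (s1 a) (fg_one _).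
Proof.
rewrite [LHS]hom11_eta; congr hom11.
have -> : hom11 a (fg_one _) = comph (hom11 a (fg_one _)) e0.
  by rewrite comp_hom11 hom11_y hom2_1.
by rewrite -P_comp -[LHS]/(hom2 (P _) (hom2 d x11)) d2 hom2_1.
Qed.

Let s2E A (g : FO A) : P (hom11 0 g) = hom11 0 (s2 g).
Proof.
rewrite [LHS]hom11_eta; congr hom11.
have -> : hom11 0 g = comph (hom11 0 g) ee by rewrite comp_hom11 linear0 hom11_x.
by rewrite -P_comp Eee comp_hom11 linear0 hom11_y.
Qed.

Lemma natural_bijections : exists (s1 : forall A, WO R A -> WO R (Phio A))
    (s2 : forall A, FO A -> FO (Phio A)),
  [/\ forall A, bijective (s1 A), forall A, bijective (s2 A),
      forall A B (m : RHom R A B) a, s1 B (hom1 m a) = hom1 (Phih m) (s1 A a) &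
      forall A B (m : RHom R A B) g, s2 B (hom2 m g) = hom2 (Phih m) (s2 A g)].
Proof.
have s1_surj A b : exists a, @s1 A a = b.
  have [m mE] := P_surj (hom11 b (fg_one _)).
  (* Precomposing [(b, 1)] with [d] scales b by the augmentation 1; hence the preimage [m] absorbs
     [e0] and has the form [(a, 1)]. *)
  have me : comph m e0 = m.
    apply: P_inj; rewrite -P_comp mE [E e0]hom11_eta d2 comp_hom11.
    by rewrite hom1_hom11_1 hom2_1 augm_d scale1r.
  exists (hom1 m y11); rewrite /s1.
  suff -> : hom11 (hom1 m y11) (fg_one _) = m by rewrite mE hom11_y.
  by rewrite [RHS]hom11_eta -{3}me /= hom11_x hom2_1.
have s2_surj A b : exists g, @s2 A g = b.
  have [m mE] := P_surj (hom11 0 b).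
  have me : comph m ee = m.
    by apply: P_inj; rewrite -P_comp mE Eee comp_hom11 linear0 hom11_x.
  exists (hom2 m x11); rewrite /s2.
  suff -> : hom11 0 (hom2 m x11) = m by rewrite mE hom11_x.
  by rewrite [RHS]hom11_eta -{2}me /= hom11_y linear0.
exists s1, s2; split.
- move=> A; apply: inj_surj_bij => // a a' aa'.
  have /P_inj/(congr1 (fun m => hom1 m y11)) :
    P (hom11 a (fg_one _)) = P (hom11 a' (fg_one _)) by rewrite !s1E aa'.
  by rewrite !hom11_y.
- move=> A; apply: inj_surj_bij => // g g' gg'.
  have /P_inj/(congr1 (fun m => hom2 m x11)) :
    P (hom11 0 g) = P (hom11 0 g') by rewrite !s2E gg'.
  by rewrite !hom11_x.
- by move=> A B m a; rewrite /s1 -(hom2_1 m) -comp_hom11 P_nat.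
- by move=> A B m g; rewrite /s2 -(linear0 (hom1 m)) -comp_hom11 P_nat.
Qed.

End Represent.
End Point.

Lemma fset0_absurd (K : choiceType) (k : (fset0 : {fset K})) : False.
Proof. by case: k => k; rewrite in_fset0. Qed.

Lemma FG_fset0 (K : choiceType) (u : FG (fset0 : {fset K})) : u = fg_one _.
Proof.
by rewrite -[u]mkFG_sval; case: (sval u) => [|[k b] s] //; case: (fset0_absurd k).
Qed.

Lemma sum_neq0_exists (V : nmodType) (I : Type) (s : seq I) (F : I -> V) :
  \sum_(i <- s) F i != 0 -> exists i, F i != 0.
Proof.
move=> s0; apply: contrapT => /forallNP F0; move/eqP: s0; apply.
by apply: big1 => i _; apply/eqP; have /negP := F0 i; rewrite negbK.
Qed.

(** * Transport of the algebraic operations along the natural bijections *)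

Section Transport.
Variables (R : idomainType) (Y0 X0 : choiceType).
Local Notation Obj := (Obj Y0 X0).
Implicit Types A B C : Obj.
Variables (Phio : Obj -> Obj)
  (Phih : forall A B, RHom R A B -> RHom R (Phio A) (Phio B))
  (Phi_aut : is_cat_aut Phih)
  (s1 : forall A, WO R A -> WO R (Phio A))
  (s2 : forall A, FO A -> FO (Phio A))
  (s1_bij : forall A, bijective (@s1 A))
  (s2_bij : forall A, bijective (@s2 A))
  (s1_nat : forall A B (m : RHom R A B) a,
    s1 (hom1 m a) = hom1 (Phih m) (s1 a))
  (s2_nat : forall A B (m : RHom R A B) g,
    s2 (hom2 m g) = hom2 (Phih m) (s2 g)).
Variables (y0 y1 : Y0) (x0 x1 : X0) (y01 : y1 != y0) (x01 : x1 != x0).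

Let s1_inj A : injective (@s1 A). Proof. exact: bij_inj. Qed.
Let s2_inj A : injective (@s2 A). Proof. exact: bij_inj. Qed.
Let s1_surj A b : exists a, @s1 A a = b.
Proof. by have [t _ tK] := s1_bij A; exists (t b). Qed.
Let s2_surj A b : exists a, @s2 A a = b.
Proof. by have [t _ tK] := s2_bij A; exists (t b). Qed.

Let OO : Obj := (fset0, fset0).
Let from0 A : RHom R OO A :=
  lift_hom (A := OO) (fun _ => 0) (fun _ => fg_one _).

(** The representation without generators has zero module. Surjectivity fixes the value there, and
    naturality along [from0] carries it to every object. *)
Let s1_0 A : s1 (0 : WO R A) = 0.
Proof.
have [a aE] := s1_surj (0 : WO R (Phio OO)).
have a0 : a = 0 by apply: wcoord_ext => -[k g]; case: (fset0_absurd k).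
by rewrite -(linear0 (hom1 (from0 A))) s1_nat -a0 aE linear0.
Qed.

Let s2_1 A : s2 (fg_one A.2) = fg_one _.
Proof.
have [a aE] := @s2_surj OO (fg_one _).
by rewrite -(hom2_1 (from0 A)) s2_nat -(FG_fset0 a) aE hom2_1.
Qed.

Section Additivity.
Let obj20 : Obj := ([fset y0; y1], fset0).
Let p0 : obj20.1 := [` fset21 y0 y1].
Let p1 : obj20.1 := [` fset22 y0 y1].
Let m2 B (a b : WO R B) : RHom R obj20 B :=
  lift_hom (A := obj20) (fun y => if y == p0 then a else b) (fun _ => fg_one _).

Let m2_0 B a b : hom1 (@m2 B a b) (ygen _ p0) = a.
Proof. by rewrite lift_hom1 eqxx. Qed.

Let p10 : (p1 == p0) = false.
Proof. by apply/negP => /eqP/(congr1 val)/eqP; rewrite (negbTE y01). Qed.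

Let m2_1 B a b : hom1 (@m2 B a b) (ygen _ p1) = b.
Proof. by rewrite lift_hom1 p10. Qed.

Lemma transport_add A (a b : WO R A) : s1 (a + b) = s1 a + s1 b.
Proof.
have [c cE] := s1_surj (s1 (ygen R p0) + s1 (ygen R p1)).
have m2c B (a' b' : WO R B) : s1 (hom1 (m2 a' b') c) = s1 a' + s1 b'.
  by rewrite s1_nat cE linearD /= -!s1_nat m2_0 m2_1.
(* Setting one generator to zero isolates the part of [c] in the other. *)
have c0 : hom1 (m2 (ygen R p0) 0) c = ygen R p0.
  by apply: s1_inj; rewrite m2c s1_0 addr0.
have c1 : hom1 (m2 0 (ygen R p1)) c = ygen R p1.
  by apply: s1_inj; rewrite m2c s1_0 add0r.
suff -> : a + b = hom1 (m2 a b) c by rewrite m2c.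
suff -> : c = ygen R p0 + ygen R p1 by rewrite linearD /= m2_0 m2_1.
(* Each term of [c] involves one of the two generators, so it survives in exactly one of the two
   specialisations. *)
rewrite -[in RHS]c0 -c1 !hom1_expand -big_split [LHS]W_expand.
apply: eq_bigr => -[y g] _; rewrite /= -scalerDr; congr (_ *: _).
rewrite (FG_fset0 g) !hom2_1 !wact1 -/(ygen R y) !lift_hom1.
case: eqP => [->|/eqP yp]; first by rewrite addr0.
rewrite add0r; congr ygen; apply: val_inj => /=; apply/eqP.
have : val y != y0 by apply: contraNneq yp => yy0; apply/eqP/val_inj.
by have := valP y; rewrite !inE => /orP[->|].
Qed.

End Additivity.

(** The elements [s1 y] and [s2 x] have the universal property of free generators of [Phio A], so
    [l] can send them back to the generators of A. It follows that every element of [Phio A] is an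
    expression in them. *)
Lemma transport_generators A : exists (k : RHom R A (Phio A)) (l : RHom R (Phio A) A),
  [/\ forall y, hom1 k (ygen _ y) = s1 (ygen _ y),
      forall x, hom2 k (fg_gen x) = s2 (fg_gen x) & comph k l = idh R _].
Proof.
pose k := lift_hom (A := A) (fun y => s1 (ygen R y)) (fun x => s2 (fg_gen x)).
(* The universal property into values of [Phio]: lift chosen preimages of [f] and [h], then apply
   the functor. Bijectivity of [Phio] makes A itself such a value. *)
have kP C : (exists B, Phio B = C) -> forall (f : A.1 -> WO R C) (h : A.2 -> FO C),
    exists l : RHom R (Phio A) C, (forall y, hom1 l (s1 (ygen R y)) = f y) /\
      (forall x, hom2 l (s2 (fg_gen x)) = h x).
  move=> [B <-] f h.
  pose m := lift_hom (A := A) (fun y => sval (cid (s1_surj (f y))))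
    (fun x => sval (cid (s2_surj (h x)))).
  exists (Phih m); split=> [y|x].
    by rewrite -s1_nat lift_hom1; case: cid.
  by rewrite -s2_nat lift_hom2; case: cid.
have [|l [l1 l2]] := kP A _ (@ygen R _ _ A) (@fg_gen _).
  by case: Phi_aut => -[Psi _ PsiK] _ _ _; exists (Psi A).
exists k, l; split => [y|x|]; rewrite ?lift_hom1 ?lift_hom2 //.
have [m mE] : exists m, Phih m = comph k l.
  by case: Phi_aut => _ /(_ A A)[g _ gK] _ _; exists (g (comph k l)).
(* The composite fixes all [s1 y] and [s2 x], so its preimage under the functor fixes the generators
   of A. *)
suff m1 : m = idh R A by rewrite -mE m1; case: Phi_aut.
apply: RHom_ext => [y|x].
  by apply: s1_inj; rewrite s1_nat mE /= l1 lift_hom1.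
by apply: s2_inj; rewrite s2_nat mE /= l2 lift_hom2.
Qed.

(** * Transport of scalars: the ring automorphism *)

Section Scalars.
Let obj10 : Obj := ([fset y0], fset0).
Let yp := ygen R (A := obj10) [` fset11 y0].

Let W10 (a : WO R obj10) : exists r, a = r *: yp.
Proof.
exists (\sum_(k <- supp a) wcoord k a); rewrite {1}[a]W_expand scaler_suml.
apply: eq_bigr => -[y g] _.
by rewrite (FG_fset0 g) (fset1_sub_eq y [` fset11 y0]).
Qed.

Let yp_inj : injective (fun r : R => r *: yp).
Proof.
move=> r r' e; apply/eqP; rewrite -subr_eq0; apply/eqP.
by apply: (W_torsion_free (a := yp)); rewrite ?wgen_neq0 // scalerBl e subrr.
Qed.

Lemma transport_scale : exists2 psi : {rmorphism R -> R}, bijective psi &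
  forall A r (a : WO R A), s1 (psi r *: a) = r *: s1 a.
Proof.
have psiP r : exists t, s1 (t *: yp) = r *: s1 yp.
  by have [c cE] := s1_surj (r *: s1 yp); have [t ct] := W10 c; exists t; rewrite -ct.
pose psi r := sval (cid (psiP r)).
have psi_yp r : s1 (psi r *: yp) = r *: s1 yp by rewrite /psi; case: cid.
have psiZ A r (a : WO R A) : s1 (psi r *: a) = r *: s1 a.
  pose m := lift_hom (A := obj10) (fun _ => a) (fun _ => fg_one A.2).
  have <- : hom1 m yp = a by rewrite lift_hom1.
  by rewrite -linearZ_LR !s1_nat psi_yp linearZ.
have eqZ r t : s1 (r *: yp) = s1 (t *: yp) -> r = t by move/s1_inj/yp_inj.
have s1yp : s1 yp != 0.
  by apply/eqP; rewrite -(s1_0 obj10) => /s1_inj/eqP; rewrite (negbTE (wgen_neq0 _ _)).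
have psiB : zmod_morphism psi.
  move=> r t; apply: eqZ; rewrite psi_yp scalerBl.
  rewrite scalerDl transport_add psi_yp; congr (_ + _).
  have := transport_add (psi t *: yp) (- psi t *: yp).
  rewrite scaleNr subrr s1_0 psi_yp => /esym/eqP.
  by rewrite addrC addr_eq0 => /eqP.
have psiM : monoid_morphism psi.
  split=> [|r t]; apply: eqZ; first by rewrite psi_yp !scale1r.
  by rewrite psi_yp -!scalerA !psiZ.
pose phi : {rmorphism R -> R} := HB.pack psi
  (GRing.isZmodMorphism.Build R R psi psiB)
  (GRing.isMonoidMorphism.Build R R psi psiM).
exists phi => //; apply: inj_surj_bij => [r t /= rt|c].
  have e : r *: s1 yp = t *: s1 yp by rewrite -!psi_yp rt.
  apply/eqP; rewrite -subr_eq0; apply/eqP.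
  by apply: W_torsion_free s1yp; rewrite scalerBl e subrr.
have [k [l [k1 _ kl]]] := transport_generators obj10.
(* Surjectivity: [l] sends [s1 (c *: yp)] to some multiple [t *: yp], and applying [k] gives
   [t *: s1 yp]; hence [psi t] is [c]. *)
have [t tE] := W10 (hom1 l (s1 (c *: yp))); exists t; apply: eqZ.
rewrite psi_yp -k1 -linearZ_LR -tE.
exact: (congr1 (fun m => hom1 m (s1 (c *: yp))) kl).
Qed.

End Scalars.

(** * Transport of the group action *)

Section Action.
Local Notation hom11 := (hom11 y0 x0).
Local Notation y11 := (y11 R y0 x0).
Local Notation x11 := (x11 y0 x0).
Local Notation obj11 := (obj11 y0 x0).
Let obj12 : Obj := ([fset y0], [fset x0; x1]).
Let y12 : WO R obj12 := ygen R (A := obj12) [` fset11 y0].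
Let u1 : FO obj12 := fg_gen (L := obj12.2) [` fset21 x0 x1].
Let u2 : FO obj12 := fg_gen (L := obj12.2) [` fset22 x0 x1].
Let m12 B (a : WO R B) (g h : FO B) : RHom R obj12 B :=
  lift_hom (A := obj12) (fun _ => a)
    (fun x => if x == [` fset21 x0 x1] then g else h).

Let m12u1 B a g h : hom2 (@m12 B a g h) u1 = g.
Proof. by rewrite lift_hom2 eqxx. Qed.

Let m12u2 B a g h : hom2 (@m12 B a g h) u2 = h.
Proof.
rewrite lift_hom2; case: eqP => // /(congr1 val)/= /eqP.
by rewrite (negbTE x01).
Qed.

Let hom2_id (m : RHom R obj11 obj11) : hom2 m x11 = x11 -> hom2 m =1 id.
Proof.
move=> mx; apply: group_hom_ext => //; first exact: hom2_mul.
by move=> x; rewrite (fset1_sub_eq x [` fset11 x0]).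
Qed.

Let hom2_trivial (m : RHom R obj11 obj11) :
  hom2 m x11 = fg_one _ -> hom2 m =1 fun _ => fg_one _.
Proof.
move=> mx; apply: group_hom_ext; first exact: hom2_mul.
  by move=> u v; rewrite fg_mul1g.
by move=> x; rewrite (fset1_sub_eq x [` fset11 x0]).
Qed.

(* Evaluating q(x1) q(x2) = q(w) at the coefficient of u(x1) v(x2), and then
   killing either generator, forces u = v for any u, v in the support of q. *)
Lemma transport_act_monomial : exists u : FO obj11, forall A (a : WO R A) g,
  s1 (wact a (hom2 (hom11 a g) u)) = wact (s1 a) (s2 g).
Proof.
have [q qE] := s1_surj (wact (s1 y11) (s2 x11)).
have act A (a : WO R A) g : s1 (hom1 (hom11 a g) q) = wact (s1 a) (s2 g).
  by rewrite s1_nat qE hom_compat -s1_nat -s2_nat hom11_y hom11_x.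
have [w wE] := s2_surj (fg_mul (s2 u1) (s2 u2)).
have qq : hom1 (hom11 y12 w) q = hom1 (hom11 (hom1 (hom11 y12 u1) q) u2) q.
  by apply: s1_inj; rewrite !act wE wactM.
(* [pi1] and [pi2] kill one group generator each and send the other to x; both send w to x because
   [s2] preserves the unit. *)
pose pi1 := m12 y11 x11 (fg_one _); pose pi2 := m12 y11 (fg_one _) x11.
have pi1w : hom2 pi1 w = x11.
  by apply: s2_inj; rewrite s2_nat wE hom2_mul -!s2_nat m12u1 m12u2 s2_1 fg_mulg1.
have pi2w : hom2 pi2 w = x11.
  by apply: s2_inj; rewrite s2_nat wE hom2_mul -!s2_nat m12u1 m12u2 s2_1 fg_mul1g.
pose i1 := hom2 (hom11 y12 u1); pose i2 := hom2 (hom11 (hom1 (hom11 y12 u1) q) u2).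
pose iw := hom2 (hom11 y12 w).
have pi1i1 u : hom2 pi1 (i1 u) = u.
  by apply: (hom2_id (m := comph pi1 (hom11 _ _))); rewrite /= hom11_x m12u1.
have pi1i2 u : hom2 pi1 (i2 u) = fg_one _.
  by apply: (hom2_trivial (m := comph pi1 (hom11 _ _))); rewrite /= hom11_x m12u2.
have pi2i1 u : hom2 pi2 (i1 u) = fg_one _.
  by apply: (hom2_trivial (m := comph pi2 (hom11 _ _))); rewrite /= hom11_x m12u1.
have pi2i2 u : hom2 pi2 (i2 u) = u.
  by apply: (hom2_id (m := comph pi2 (hom11 _ _))); rewrite /= hom11_x m12u2.
have pi1iw u : hom2 pi1 (iw u) = u.
  by apply: (hom2_id (m := comph pi1 (hom11 _ _))); rewrite /= hom11_x.
have pi2iw u : hom2 pi2 (iw u) = u.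
  by apply: (hom2_id (m := comph pi2 (hom11 _ _))); rewrite /= hom11_x.
have yE (y : obj11.1) : y = [` fset11 y0] by exact: fset1_sub_eq.
have key_eq (k l : key obj11.1 obj11.2) : k.2 = l.2 -> k = l.
  by case: k l => [k1 k2] [l1 l2] /= ->; rewrite (yE k1) (yE l1).
have qq2 : hom1 (hom11 y12 w) q = \sum_(l <- supp q) wcoord l q *:
    \sum_(k <- supp q) wcoord k q *: wact y12 (fg_mul (i1 k.2) (i2 l.2)).
  rewrite qq [LHS]hom1_expand; apply: eq_bigr => l _; congr (_ *: _).
  rewrite (yE l.1) hom11_y -/i2 [X in wact X _]hom1_expand wact_sum.
  by apply: eq_bigr => k _; rewrite wactZ (yE k.1) hom11_y wactM.
have supp_eq k l : k \in supp q -> l \in supp q -> k = l.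
  move=> kq lq; apply: (key_eq _ _).
  pose K : key obj12.1 obj12.2 := ([` fset11 y0], fg_mul (i1 k.2) (i2 l.2)).
  have cK h : wcoord K (wact y12 h) = (fg_mul (i1 k.2) (i2 l.2) == h)%:R.
    by rewrite wact_gen fg_mul1g wcoord_gen xpair_eqE eqxx.
  (* The projections recover [k.2] and [l.2] from the product, so a single term of the double sum
     reaches [K]. *)
  have qK : wcoord K (hom1 (hom11 y12 w) q) = wcoord l q * wcoord k q.
    rewrite qq2 linear_sum (bigD1_seq l) ?supp_uniq //=.
    rewrite linearZ /= linear_sum (bigD1_seq k) ?supp_uniq //=.
    rewrite linearZ /= cK eqxx [_ *: 1]mulr1 !big1 ?addr0 // => [l' l'l|k' k'k].
      rewrite linearZ /= linear_sum big1 ?scaler0 // => k' _.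
      rewrite linearZ /= cK; case: eqP => [e|_]; last by rewrite [LHS]mulr0.
      case/eqP: l'l; apply: (key_eq _ _); move/(congr1 (hom2 pi2)): e.
      by rewrite !hom2_mul !pi2i1 !pi2i2 !fg_mul1g.
    rewrite linearZ /= cK; case: eqP => [e|_]; last by rewrite [LHS]mulr0.
    case/eqP: k'k; apply: (key_eq _ _); move/(congr1 (hom2 pi1)): e.
    by rewrite !hom2_mul !pi1i1 !pi1i2 !fg_mulg1.
  (* This nonzero coefficient must also occur in q(w). The product is then the image of some [j.2]
     under x -> w, and both projections return [j.2]. *)
  have : wcoord K (hom1 (hom11 y12 w) q) != 0 by rewrite qK mulf_neq0 -?mem_supp.
  rewrite hom1_expand linear_sum => /sum_neq0_exists[j].
  rewrite linearZ /= (yE j.1) hom11_y cK.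
  have [e _|_] := fg_mul (i1 k.2) (i2 l.2) =P hom2 (hom11 y12 w) j.2; last first.
    by rewrite scaler0 eqxx.
  have := congr1 (hom2 pi1) e; have := congr1 (hom2 pi2) e.
  rewrite !hom2_mul -/iw pi1iw pi2iw pi1i1 pi1i2 pi2i1 pi2i2.
  by rewrite fg_mul1g fg_mulg1 => -> ->.
have q0 : q != 0.
  apply/eqP => q0; have := qE; rewrite q0 s1_0 => /esym e.
  have /wact_inj : wact (s1 y11) (s2 x11) = wact 0 (s2 x11).
    by rewrite e -(scale0r (s1 y11)) wactZ !scale0r.
  by rewrite -(s1_0 obj11) => /s1_inj/eqP; rewrite (negbTE (wgen_neq0 _ _)).
have [k [c qk]] : exists k c, q = c *: wact y11 k.
  have := W_expand q; have := supp_uniq q; have := supp_eq.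
  case: (supp q) => [|k [|l s]] sE us qs.
  - by move: q0; rewrite qs big_nil eqxx.
  - exists k.2, (wcoord k q); rewrite {1}qs big_seq1 wgen_ygen.
    by rewrite (yE k.1).
  - have kl : k = l by apply: sE; rewrite !inE eqxx ?orbT.
    by move: us; rewrite kl /= inE eqxx.
(* The unit acts trivially on both sides, which normalises the coefficient. *)
have c1 : c = 1.
  have := act _ y11 (fg_one _); rewrite s2_1 wact1 qk => /s1_inj.
  rewrite linearZ /= hom_compat hom11_y hom2_hom11_1 wact1 => e.
  apply/eqP; rewrite -subr_eq0; apply/eqP.
  by apply: (W_torsion_free (a := y11)); rewrite ?wgen_neq0 // scalerBl e scale1r subrr.
by exists k => A a g; rewrite -act qk c1 scale1r hom_compat hom11_y.
Qed.

(* The sign ambiguity is that of the choice of a generator of the cyclic group. *)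
Lemma transport_act : exists b : bool,
  forall A (a : WO R A) g,
    s1 (wact a g) = wact (s1 a) (s2 (if b then g else fg_inv g)).
Proof.
have [u uP] := transport_act_monomial.
have [psi _ psiP] := transport_scale.
have [k [l [k1 k2 kl]]] := transport_generators obj11.
have x1E := @fset1_sub_eq _ x0.
pose v g := sval (cid (s2_surj (hom2 k g))).
have vE g : s2 (v g) = hom2 k g by rewrite /v; case: cid.
(* Expand [s1 (y x)] in the generators [s1 y] and [s2 x], and pull back. Every term is then a
   multiple of y times a value of the word u, and some term must contribute to the coefficient at
   x. *)
have [j ju] : exists g : FO obj11, hom2 (hom11 y11 g) u = x11.
  pose c := hom1 l (s1 (wact y11 x11)).
  have zE : wact y11 x11 = \sum_(i <- supp c)
      psi (wcoord i c) *: wact y11 (hom2 (hom11 y11 (v i.2)) u).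
    apply: s1_inj; rewrite (big_morph _ (@transport_add obj11) (s1_0 obj11)).
    rewrite -[LHS](congr1 (fun m => hom1 m (s1 (wact y11 x11))) kl) /= -/c.
    rewrite hom1_expand; apply: eq_bigr => i _; rewrite psiP uP vE k1.
    by rewrite (fset1_sub_eq i.1 [` fset11 y0]).
  have := congr1 (wcoord (([` fset11 y0] : obj11.1), x11)) zE.
  rewrite wact_gen fg_mul1g wcoord_gen eqxx linear_sum => e1.
  have : \sum_(i <- supp c) (wcoord (([` fset11 y0] : obj11.1), x11)
      (psi (wcoord i c) *: wact y11 (hom2 (hom11 y11 (v i.2)) u)) : R) != 0.
    by rewrite -e1 oner_eq0.
  move/sum_neq0_exists => [i]; rewrite linearZ /= wact_gen fg_mul1g wcoord_gen.
  rewrite xpair_eqE eqxx /= => ne; exists (v i.2).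
  by apply/esym/eqP; apply: contraNT ne => /negPf->; rewrite scaler0.
(* The exponent of u is thus a unit of the integers, and u is x or its inverse. *)
have eju : expo j * expo u = 1.
  have <- : expo x11 = 1 by exact: expo_gen.
  rewrite -ju (expo_cyclic_hom (@hom2_mul _ _ _ _ _ (hom11 y11 j)) [` fset11 x0] _ x1E).
  by rewrite -/x11 hom11_x.
have u1' : `|expo u|%N = 1%N.
  by have := congr1 absz eju; rewrite abszM => /eqP; rewrite muln_eq1 => /andP[_ /eqP].
have uE := cyclic_expo1 [` fset11 x0] x1E u1'.
exists (expo u == 1) => A a g.
move: uE; case: ifP => _ uE; rewrite -uP uE; first by rewrite -/x11 hom11_x.
rewrite (group_homV (@hom2_mul _ _ _ _ _ (hom11 a (fg_inv g)))).
by rewrite -/x11 hom11_x fg_invK.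
Qed.

(** Naturality reduces the claim to the two free generators [u1], [u2]. There both sides act alike
    on every vector, and the action on a basis vector is free. *)
Lemma transport_act_hom b :
  (forall A (a : WO R A) g,
    s1 (wact a g) = wact (s1 a) (s2 (if b then g else fg_inv g))) ->
  forall A, group_hom (fun g : FO A => s2 (if b then g else fg_inv g)).
Proof.
move=> actP A g h.
have iE B C (m : RHom R B C) (g' : FO B) :
    (if b then hom2 m g' else fg_inv (hom2 m g')) = hom2 m (if b then g' else fg_inv g').
  by case: b {actP} => //; rewrite (group_homV (@hom2_mul _ _ _ _ _ m)).
pose m := m12 0 g h.
have <- : hom2 m u1 = g by exact: m12u1.
have <- : hom2 m u2 = h by exact: m12u2.
rewrite -hom2_mul !iE !s2_nat -hom2_mul; congr hom2.
(* Injectivity makes [s1 y12] nonzero, so the image object has at least one module generator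
   [k.1]. *)
have [k _] : exists k, wcoord k (s1 y12) != 0.
  apply: contrapT => /forallNP k0.
  have /eqP := wgen_neq0 R ([` fset11 y0] : obj12.1, fg_one obj12.2).
  apply; apply: s1_inj; rewrite s1_0; apply: wcoord_ext => k.
  by apply/eqP; have /negP := k0 k; rewrite negbK.
have [a aE] := s1_surj (ygen R k.1).
have : wact (s1 a) (s2 (if b then fg_mul u1 u2 else fg_inv (fg_mul u1 u2))) =
  wact (s1 a) (fg_mul (s2 (if b then u1 else fg_inv u1))
                      (s2 (if b then u2 else fg_inv u2))).
  by rewrite -actP -!wactM !actP.
by rewrite aE !wact_gen !fg_mul1g => /wgen_inj[].
Qed.

End Action.

End Transport.

(** * Isomorphisms, inner automorphisms and the final decomposition *)

Lemma RHom_bij_iso (R : comNzRingType) (Y0 X0 : choiceType) (A B : Obj Y0 X0)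
    (m : RHom R A B) : bijective (hom1 m) -> bijective (hom2 m) ->
  exists n : RHom R B A, comph n m = idh R A /\ comph m n = idh R B.
Proof.
move=> [n1 mK1 nK1] [n2 mK2 nK2].
have n1D a b : n1 (wadd a b) = wadd (n1 a) (n1 b).
  by apply: (can_inj mK1); rewrite hom1_add !nK1.
have n1Z r a : n1 (wscale r a) = wscale r (n1 a).
  by apply: (can_inj mK1); rewrite hom1_scale !nK1.
have n2M : group_hom n2.
  by move=> g h; apply: (can_inj mK2); rewrite hom2_mul !nK2.
have n12 a g : n1 (wact a g) = wact (n1 a) (n2 g).
  by apply: (can_inj mK1); rewrite hom_compat nK1 nK2 nK1.
by exists (mkHom n1D n1Z n2M n12); split; apply: RHom_eqP.
Qed.

Lemma inner_is_cat_aut (R : comNzRingType) (Y0 X0 : choiceType)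
    (Fo : Obj Y0 X0 -> Obj Y0 X0)
    (Fh : forall A B, RHom R A B -> RHom R (Fo A) (Fo B)) :
  bijective Fo -> is_inner Fh -> is_cat_aut Fh.
Proof.
move=> Fo_bij [s [si [sK FhE]]]; split=> //.
- move=> A B; exists (fun m => comph (si B) (comph m (s A))) => m; rewrite FhE.
    have [sA _] := sK A; have [sB _] := sK B.
    by rewrite !comphA sB comph1h -comphA sA comphh1.
  have [_ sA] := sK A; have [_ sB] := sK B.
  by rewrite !comphA sB comph1h -comphA sA comphh1.
- by move=> A; rewrite FhE comph1h; case: (sK A).
move=> A B C n m; rewrite !FhE -!comphA; congr comph; congr comph.
by rewrite !comphA; case: (sK B) => -> _; rewrite comph1h.
Qed.

Theorem mainTheorem17 (R : idomainType) (Y0 X0 : choiceType)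
  (Y0_inf : forall s : seq Y0, exists y, y \notin s)
  (X0_inf : forall s : seq X0, exists x, x \notin s)
  (Phio : Obj Y0 X0 -> Obj Y0 X0)
  (Phih : forall A B, RHom R A B -> RHom R (Phio A) (Phio B))
  (Phi_aut : is_cat_aut Phih)
  (Phi_W1 : exists (y : Y0) (x : X0),
      iso_obj R (Phio ([fset y], [fset x])) ([fset y], [fset x])) :
  exists (phi phii : {rmorphism R -> R}),
    cancel phi phii /\ cancel phii phi /\
    exists Psih : forall A B, RHom R A B -> RHom R (Phio A) (Phio B),
      is_cat_aut Psih /\ is_inner Psih /\
      forall A B (m : RHom R A B),
        (forall w, hom1 (Phih A B m) w
                   = wmap phi (hom1 (Psih A B m) (wmap phii w))) /\
        (forall g, hom2 (Phih A B m) g = hom2 (Psih A B m) g).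
Proof.
have [y0 [x0 [tau [taui [tauK tauiK]]]]] := Phi_W1.
(* Infinitude provides second generators, for the two-variable test objects. *)
have [y1] := Y0_inf [:: y0]; rewrite inE => y01.
have [x1] := X0_inf [:: x0]; rewrite inE => x01.
have [s1 [s2 [s1_bij s2_bij s1_nat s2_nat]]] := natural_bijections Phi_aut tauK tauiK.
have s1D := transport_add s1_bij s1_nat y01.
have [psi psi_bij psiZ] := transport_scale Phi_aut s1_bij s2_bij s1_nat s2_nat y01.
have [b act] := transport_act Phi_aut s1_bij s2_bij s1_nat s2_nat y01 x01.
have tM := transport_act_hom s1_bij s1_nat s2_nat y0 x01 act.
pose t2 A (g : FO A) := s2 A (if b then g else fg_inv g).
have t2_nat A B (m : RHom R A B) g : t2 B (hom2 m g) = hom2 (Phih A B m) (t2 A g).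
  by rewrite -s2_nat /t2; case: (b); rewrite // (group_homV (@hom2_mul _ _ _ _ _ m)).
have t2_bij A : bijective (t2 A).
  rewrite /t2; case: (b); first exact: s2_bij.
  exact: (bij_comp (s2_bij A) (inv_bij (@fg_invK _))).
have [phi0 psiK phiK] := psi_bij.
have phiB : zmod_morphism phi0.
  by move=> r t; apply: (can_inj psiK); rewrite rmorphB !phiK.
have phiM : monoid_morphism phi0.
  by split=> [|r t]; apply: (can_inj psiK); rewrite ?rmorph1 ?rmorphM !phiK.
pose phi : {rmorphism R -> R} := HB.pack phi0
  (GRing.isZmodMorphism.Build R R phi0 phiB)
  (GRing.isMonoidMorphism.Build R R phi0 phiM).
have wphiK A (w : WO R A) : wmap phi (wmap psi w) = w.
  by apply: W_ext => k; apply: psiK.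
have wpsiK A (w : WO R A) : wmap psi (wmap phi w) = w.
  by apply: W_ext => k; apply: phiK.
(* [s1] is semilinear: it turns the scalar r into [phi r]. Applying [psi] to the coefficients undoes
   this and leaves the action intact. *)
pose t1 A (a : WO R A) := wmap psi (s1 A a).
have t1D A a a' : t1 A (wadd a a') = wadd (t1 A a) (t1 A a').
  by rewrite /t1 waddE s1D; apply: W_ext => k; apply: rmorphD.
have t1Z A r a : t1 A (wscale r a) = wscale r (t1 A a).
  rewrite /t1 wscaleE -{1}(phiK r) psiZ; apply: W_ext => k /=.
  by rewrite rmorphM phiK.
have t12 A a g : t1 A (wact a g) = wact (t1 A a) (t2 A g).
  by rewrite /t1 act; apply: W_ext.
pose s A : RHom R A (Phio A) := mkHom (t1D A) (t1Z A) (tM A) (t12 A).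
have t1_bij A : bijective (t1 A).
  apply: (@bij_comp _ _ _ (wmap psi)); last exact: s1_bij.
  by exists (wmap phi).
have sP A := cid (RHom_bij_iso (m := s A) (t1_bij A) (t2_bij A)).
pose si A := sval (sP A).
have siP A : comph (si A) (s A) = idh R A /\ comph (s A) (si A) = idh R (Phio A).
  exact: (svalP (sP A)).
pose Psih A B (m : RHom R A B) := comph (s B) (comph m (si A)).
have Psi_inner : is_inner Psih by exists s, si.
(* The twist is by the inverse [phi] of [psi], since [s1] is [t1] followed by [wmap phi]. *)
exists phi, psi; split=> //; split=> //; exists Psih.
split; first by apply: inner_is_cat_aut => //; case: Phi_aut.
split=> // A B m; have [siK _] := siP A; split=> [w|g].
  (* With w written as [s1 a], the inner part sends [t1 a] to [t1] of the image of a, and untwisting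
     leaves the naturality of [s1]. *)
  have [a <-] : exists a, s1 A a = w.
    by have [f _ fK] := s1_bij A; exists (f w).
  have -> : wmap psi (s1 A a) = hom1 (s A) a by [].
  rewrite /= (congr1 (fun n => hom1 n a) siK : hom1 (si A) (hom1 (s A) a) = a).
  by rewrite wphiK s1_nat.
have [h <-] : exists h, t2 A h = g by have [f _ fK] := t2_bij A; exists (f g).
have -> : t2 A h = hom2 (s A) h by [].
rewrite /= (congr1 (fun n => hom2 n h) siK : hom2 (si A) (hom2 (s A) h) = h).
by rewrite -/(t2 B _) t2_nat.
Qed.
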